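(* Let $n\in\mathbb{N}$, let $P_1,\dots,P_n$ be polynomials in $d$ variables with coefficients in $\mathbb{C}$, let $x_0\in\mathbb{C}^d$ and $l\in\mathbb{Z}_{\ge0}$. Let $v\in\mathbb{C}^{\tilde d(l)}$ be such that the function $e^{ix_0\cdot x}[\widetilde{\mathcal{P}}_l(x)]v$ is non-zero. Then this function belongs to the null-space $\bigcap_{j=1}^n\ker P_j(-iD)$ of the system $$P_1(-iD)u=0,\ \dots,\ P_n(-iD)u=0$$ if and only if $v$ belongs to the null-space of the block matrix $$\begin{bmatrix}\widetilde{\mathbf{D}}_lP_1(x_0)\\ \vdots\\ \widetilde{\mathbf{D}}_lP_n(x_0)\end{bmatrix}$$ and $P_1(x_0)=\cdots=P_n(x_0)=0$.
   Context: Here $d\in\mathbb{N}$ and $x\cdot y=x_1y_1+\cdots+x_dy_d$. For $k\in\mathbb{Z}_{\ge0}$, $\mathcal{A}_k$ is the list of all multi-indices $\alpha\in\mathbb{Z}_{\ge0}^d$ of length $|\alpha|=\alpha_1+\dots+\alpha_d=k$, ordered by a fixed lexicographical order. $\widetilde{\mathcal{A}}_l=(\mathcal{A}_0,\dots,\mathcal{A}_l)$ is the concatenated list, of length $\tilde d(l)=\frac{(d+l)!}{l!\,d!}$. $[\widetilde{\mathcal{P}}_l(x)]$ is the row vector of monomials $x^\alpha$, $\alpha$ running through $\widetilde{\mathcal{A}}_l$ in order. Write $\beta\le\alpha$ if $\beta_s\le\alpha_s$ for all $s$; $\binom{\alpha}{\beta}=\prod_s\binom{\alpha_s}{\beta_s}$;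 $D^\gamma=D_1^{\gamma_1}\cdots D_d^{\gamma_d}$ with $D_n$ the partial derivative in the $n$th coordinate. For a polynomial $P$, $\widetilde{\mathbf{D}}_lP(x_0)$ is the $\tilde d(l)\times\tilde d(l)$ matrix with rows and columns indexed by $\widetilde{\mathcal{A}}_l$, whose entry in row $\beta$ and column $\alpha$ is $(-i)^{|\alpha-\beta|}\binom{\alpha}{\beta}D^{\alpha-\beta}P(x_0)$ if $\beta\le\alpha$, and $0$ otherwise. Null-space of a matrix means right null-space over $\mathbb{C}$. $P(-iD)$ is the constant coefficient differential operator obtained by substituting $-iD_s$ for the $s$th variable of $P$. *)

(* Defs.v *)
From HB Require Import structures.
From mathcomp Require Import all_boot all_order all_algebra.
From mathcomp Require Import all_classical all_reals all_analysis.
From mathcomp Require Import zify.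
From mathcomp Require Import complex.
(* The notations of multinomials clash with those of mathcomp-analysis. *)
From mathcomp.multinomials Require Import -(notations) mpoly.

Set Implicit Arguments.
Unset Strict Implicit.
Unset Printing Implicit Defensive.

Import Order.TTheory GRing.Theory Num.Theory numFieldNormedType.Exports.

Local Open Scope classical_set_scope.
Local Open Scope ring_scope.
Local Open Scope complex_scope.

Section MultiIndices.
Variable d : nat.

(* On multi-indices of equal length, [<=%O] is the lexicographical order. *)
Definition indices_eq (k : nat) : seq (multinom d) :=
  sort <=%O [seq m <- [seq bmnm b | b <- enum {: bmultinom d k.+1}] | mdeg m == k].

Definition indices_le (l : nat) : seq (multinom d) :=
  flatten [seq indices_eq k | k <- iota 0 l.+1].

Lemma mem_indices_eq k m : (m \in indices_eq k) = (mdeg m == k).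
Proof.
rewrite mem_sort mem_filter; case: eqP => //= mk.
have lt : (mdeg m < k.+1)%N by rewrite mk.
by apply/mapP; exists (BMultinom lt); rewrite ?mem_enum.
Qed.

Lemma uniq_indices_eq k : uniq (indices_eq k).
Proof.
rewrite sort_uniq filter_uniq // map_inj_uniq ?enum_uniq //.
exact: val_inj.
Qed.

Lemma mem_indices_le l m : (m \in indices_le l) = (mdeg m <= l)%N.
Proof.
apply/flattenP/idP => [[s /mapP[k]]|le_ml].
  by rewrite mem_iota add0n ltnS => le_kl ->; rewrite mem_indices_eq => /eqP->.
exists (indices_eq (mdeg m)); last by rewrite mem_indices_eq.
by apply/mapP; exists (mdeg m); rewrite // mem_iota add0n ltnS.
Qed.

Lemma indices_leS l :
  indices_le l.+1 = indices_le l ++ indices_eq l.+1.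
Proof. by rewrite /indices_le -[in LHS]addn1 iotaD map_cat flatten_cat /= cats0. Qed.

Lemma uniq_indices_le l : uniq (indices_le l).
Proof.
elim: l => [|l IH]; first by rewrite /indices_le /= cats0 uniq_indices_eq.
rewrite indices_leS cat_uniq IH uniq_indices_eq andbT /=.
apply/hasPn => m; rewrite mem_indices_eq mem_indices_le => /eqP->.
by rewrite ltnn.
Qed.

Definition dtilde (l : nat) : nat := ((d + l)`! %/ (l`! * d`!))%N.

Definition multi_index (l : nat) (j : 'I_(dtilde l)) : multinom d :=
  nth mnm0 (indices_le l) j.

Definition mbin (a b : multinom d) : nat := (\prod_(s < d) 'C(a s, b s))%N.

End MultiIndices.

Lemma dtildeE d l : dtilde d l = 'C(d + l, l).
Proof. by rewrite /dtilde -(bin_fact (leq_addl d l)) addnK mulnK // muln_gt0 !fact_gt0. Qed.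

Lemma size_indices_eq d k : size (indices_eq d.+1 k) = 'C(k + d, k).
Proof.
rewrite -(size_basis d k); apply: perm_size; apply: uniq_perm.
- exact: uniq_indices_eq.
- exact: uniq_basis.
by move=> m; rewrite mem_indices_eq basis_cover.
Qed.

Lemma size_indices_le d l : size (indices_le d l) = dtilde d l.
Proof.
rewrite dtildeE; case: d => [|d].
  rewrite add0n binn; have -> : 1%N = size [:: mnm0 : multinom 0] by [].
  apply: perm_size; apply: uniq_perm => //; first exact: uniq_indices_le.
  move=> m; rewrite mem_indices_le inE mdegE big_ord0 leq0n; apply/esym/eqP.
  by apply/mnmP => -[].
elim: l => [|l IH].
  by rewrite /indices_le /= cats0 size_indices_eq !bin0.
rewrite indices_leS size_cat IH size_indices_eq addSn addnS binS addnC.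
by congr (_ + _)%N; congr 'C(_, _); lia.
Qed.

Section Definitions.
Variables (R : realType) (d : nat).
Local Notation C := R[i].
Local Notation re := (@complex.Re R).
Local Notation im := (@complex.Im R).
Implicit Types (u : 'rV[R]_d -> C) (P : mpoly d C).

Definition cexp (z : C) : C :=
  (expR (re z))%:C * (cos (im z) +i* sin (im z)).

Definition monomials (l : nat) (x : 'rV[R]_d) : 'rV[C]_(dtilde d l) :=
  \row_j \prod_(s < d) (x 0 s)%:C ^+ multi_index j s.

Definition exp_poly (l : nat) (x0 : 'rV[C]_d) (v : 'cV[C]_(dtilde d l))
    : 'rV[R]_d -> C :=
  fun x => cexp ('i%C * \sum_(s < d) x0 0 s * (x 0 s)%:C)
           * (monomials l x *m v) 0 0.

Definition Dtilde (l : nat) P (x0 : 'rV[C]_d) : 'M[C]_(dtilde d l) :=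
  \matrix_(i, j)
    let b := multi_index i in let a := multi_index j in
    if lem b a
    then (- 'i%C) ^+ mdeg (mnm_sub a b) * (mbin a b)%:R
         * meval (x0 0) (mderivm (mnm_sub a b) P)
    else 0.

(* [complex R] carries no normed [R]-module structure, hence the
   differentiation of the real and imaginary parts. *)
Definition pderiv (s : 'I_d) u : 'rV[R]_d -> C :=
  fun x => derive (re \o u) x (delta_mx 0 s)
           +i* derive (im \o u) x (delta_mx 0 s).

Definition smooth u : Prop :=
  forall t : seq 'I_d, let w := foldr pderiv u t in
  [/\ continuous (re \o w), continuous (im \o w) &
      forall (s : 'I_d) (x : 'rV[R]_d),
        derivable (re \o w) x (delta_mx 0 s)
        /\ derivable (im \o w) x (delta_mx 0 s)].

Definition miD (s : 'I_d) u : 'rV[R]_d -> C := fun x => - 'i%C * pderiv s u x.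

Definition miD_pow (m : multinom d) u : 'rV[R]_d -> C :=
  foldr (fun s => iter (m s) (miD s)) u (enum 'I_d).

Definition diff_op P u : 'rV[R]_d -> C :=
  fun x => \sum_(m <- msupp P) mcoeff m P * miD_pow m u x.

(* [derive] is total, so that smoothness is needed to make the derivatives
   occurring in [diff_op] genuine ones. *)
Definition ker_op P : set ('rV[R]_d -> C) :=
  [set u | smooth u /\ forall x, diff_op P u x = 0].

End Definitions.

Definition null_space (K : pzRingType) (m n : nat) (A : 'M[K]_(m, n))
    : set 'cV[K]_n := [set v | A *m v = 0].

(* Main.v *)
Require Import Defs.
From mathcomp Require Import all_boot all_order all_algebra.
From mathcomp Require Import all_classical all_reals all_analysis.
From mathcomp Require Import complex ring.
From mathcomp.multinomials Require Import -(notations) mpoly.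

(** Write [C] for [R[i]], [e] for [- 'i] and [E q] for the exponential polynomial
    [e^(i x0.x) q(x)], [q] a polynomial.  By the product rule [- i D_s] sends
    [E q] to [E (T_s q)] with [T_s q = x0_s q + e D_s q], so that [P(-iD)] sends
    [E q] to [E (P(T) q)] ([diff_op_exp_mpoly]).  The exponential never vanishes,
    and a polynomial function that vanishes on [R^d] has all its derivatives
    zero at the origin, hence is the zero polynomial ([exp_mpoly_eq0]).  Thus
    [E q] is annihilated by [P(-iD)] exactly when [P(T) q = 0], a question of
    pure algebra.

    Taylor's formula suggests
    [P(T) X^a = \sum_(b <= a) e^|a-b| binom(a,b) (D^(a-b) P)(x0) X^b],
    the entries of the matrix of the statement.  It is proved with no
    expansion in several variables: both sides are linear in [P], agree for
    [P = 1], and satisfy the same recursion when [P] is multiplied by a variable.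
    For the right-hand side, this recursion ([symbol_entry_mulX]) is Leibniz's
    rule [D^g (X_s P) = X_s D^g P + g_s D^(g - u_s) P], [u_s] the unit
    multi-index, combined with [binom(a,b) (a_s - b_s) = binom(a,b+u_s) (b_s+1)].
    Hence, for [q = \sum_a v_a X^a], the polynomial [P(T) q] has degree at most
    [l] and coefficient vector [Dtilde P(x0) v] ([diff_op_exp_poly_eq0]).

    Finally, [P(x0) = 0] comes for free from [Dtilde P(x0) v = 0] when [v <> 0]:
    the matrix is block triangular for the length of multi-indices, with diagonal
    entries [P(x0)], so that a nonzero entry of [v] of maximal length is
    multiplied by [P(x0)] alone ([Dtilde_mul_eq0_root]). *)

Set Implicit Arguments.
Unset Strict Implicit.
Unset Printing Implicit Defensive.

Import Order.TTheory GRing.Theory Num.Theory numFieldNormedType.Exports.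

Local Open Scope classical_set_scope.
Local Open Scope ring_scope.
Local Open Scope complex_scope.

(** * Multi-indices *)

Section MultiIndexFacts.
Variable d : nat.
Implicit Types a b : multinom d.

Lemma mnm_neq0_exists a : a != mnm0 -> exists s, a s != 0%N.
Proof.
move=> a0; apply/existsP; apply: contraNT a0 => /existsPn a0.
by apply/eqP/mnmP => i; rewrite mnm0E; apply/eqP; rewrite -[_ == _]negbK a0.
Qed.

Lemma subnn_mnm a : mnm_sub a a = mnm0.
Proof. by apply/mnmP => i; rewrite mnmBE subnn mnm0E. Qed.

Lemma lem_mdeg b a : lem b a -> (mdeg b <= mdeg a)%N.
Proof. by move=> ba; rewrite -(submK ba) mdegD leq_addl. Qed.

Lemma lem_mdeg_eq b a : lem b a -> (mdeg a <= mdeg b)%N -> b = a.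
Proof.
move=> ba; rewrite -{1}(submK ba) mdegD -{2}[mdeg b]add0n leq_add2r leqn0.
by rewrite mdeg_eq0 => /eqP ab0; rewrite -(submK ba) ab0 add0m.
Qed.

Lemma mdeg_multi_index l (j : 'I_(dtilde d l)) : (mdeg (multi_index j) <= l)%N.
Proof. by rewrite -mem_indices_le mem_nth // size_indices_le. Qed.

Lemma multi_index_inj l : injective (@multi_index d l).
Proof.
move=> i j /eqP; rewrite nth_uniq ?size_indices_le ?uniq_indices_le //.
by move/eqP/val_inj.
Qed.

Lemma mderiv_mpolyXU (K : nzRingType) (s k : 'I_d) :
  mderiv s (mpolyX K (mnm1 k)) = (k == s)%:R.
Proof.
rewrite mderivX mnm1E; have [->|_] := eqVneq k s; last by rewrite scale0r.
by rewrite scale1r subnn_mnm mpolyX0.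
Qed.

End MultiIndexFacts.

(** * Conjugated operators on polynomials *)

Section ConjugatedOperators.
Variables (K : comNzRingType) (d : nat) (e : K) (c : 'I_d -> K).
Implicit Types (p q : mpoly d K) (a b : multinom d) (s : 'I_d).

(** Leibniz's rule stops after two terms because the second derivatives of a
    variable vanish.  When [a s = 0] the truncated subtraction leaves a
    meaningless derivative, cancelled by the factor [a s]. *)
Lemma mderivm_mulX s a p :
  mderivm a (mpolyX K (mnm1 s) * p)
  = mpolyX K (mnm1 s) * mderivm a p
    + mderivm (mnm_sub a (mnm1 s)) p *+ a s.
Proof.
have [n an] := ubnP (mdeg a); elim: n a an => // n IH a an.
have [->|a0] := eqVneq a mnm0; first by rewrite !mderivm0m mnm0E addr0.
have [k ak] := mnm_neq0_exists a0.
have ale : lem (mnm1 k) a by rewrite lep1mP.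
have := submK ale; set a' := mnm_sub a (mnm1 k) => aE.
have a's : (mdeg a' < n)%N by move: an; rewrite -aE mdegD mdeg1 addn1 ltnS.
rewrite -{1}aE mderivmDm mderivmU1m IH // mderivD mderivM mderivMn mderiv_mpolyXU.
rewrite -!mderivmU1m -!mderivmDm aE -[in RHS]aE mnmDE !mnm1E [k == s]eq_sym aE.
rewrite -addrA addrCA.
have [->|sk] := eqVneq s k; last first.
  rewrite mul0r addn0 add0r; congr (_ + _ *+ _).
  rewrite -aE; congr (mderivm _ p); apply/mnmP => i.
  rewrite !(mnmDE, mnmBE, mnm1E).
  have [<-|_] := eqVneq k i; last by rewrite !addn0.
  by rewrite (negPf sk) !subn0.
congr (_ + _); rewrite -/a' mul1r mulrnDr mulr1n [RHS]addrC; congr (_ + _).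
have [->|a'k] := eqVneq (a' k) 0%N; first by rewrite !mulr0n.
by rewrite submK // lep1mP.
Qed.

(** The coefficient of [X^b] in [p(T) X^a], where [T_s = c_s + e D_s] is
    [shift_op s] below: Taylor's formula for [p] at [c], the operators [e D_s]
    being the increments. *)
Definition symbol_entry p a b : K :=
  if lem b a then e ^+ mdeg (mnm_sub a b) * (mbin a b)%:R
                  * meval c (mderivm (mnm_sub a b) p)
  else 0.

Lemma mbin_shift a b s :
  (mbin a (mnm_add b (mnm1 s)) * (b s).+1 = mbin a b * (a s - b s))%N.
Proof.
rewrite /mbin (bigD1 s) //= [in RHS](bigD1 s) //=.
rewrite mnmDE mnm1E eqxx addn1 mulnAC [(_ * (b s).+1)%N]mulnC mul_bin_left.
rewrite [RHS]mulnC mulnA; congr (_ * _)%N; apply: eq_bigr => k ks.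
by rewrite mnmDE mnm1E eq_sym (negPf ks) addn0.
Qed.

Lemma symbol_entry_diag p a : symbol_entry p a a = meval c p.
Proof.
rewrite /symbol_entry lepm_refl subnn_mnm mdeg0 mderivm0m /mbin big1 ?mul1r //.
by move=> i _; rewrite binn.
Qed.

Lemma symbol_entry1 a b : symbol_entry 1 a b = (a == b)%:R.
Proof.
have [->|ab] := eqVneq a b; first by rewrite symbol_entry_diag meval1.
rewrite /symbol_entry; case: ifP => // ba.
have [k abk] : exists k, mnm_sub a b k != 0%N.
  apply: mnm_neq0_exists; apply: contra ab => /eqP ab0.
  by rewrite -(submK ba) ab0 add0m.
rewrite mderivmE msupp1 big_seq1.
rewrite (bigD1 k) //= mnm0E ffact_small ?lt0n // mul0n.
by rewrite mulr0 scale0r meval0 mulr0.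
Qed.

(** The right-hand side is the coefficient of [X^b] in [T_s] applied to the
    polynomial with coefficients [symbol_entry p a _]. *)
Lemma symbol_entry_mulX s p a b :
  symbol_entry (mpolyX K (mnm1 s) * p) a b
  = c s * symbol_entry p a b
    + e * symbol_entry p a (mnm_add b (mnm1 s)) *+ (b s).+1.
Proof.
rewrite /symbol_entry; have [ba|nba] := boolP (lem b a); last first.
  have /negPf -> : ~~ lem (mnm_add b (mnm1 s)) a.
    by apply: contra nba; apply: lepm_trans; apply: lem_addr.
  by rewrite !mulr0 mul0rn addr0.
set g := mnm_sub a b.
have gs : (a s - b s)%N = g s by rewrite mnmBE.
rewrite mderivm_mulX mevalD mevalM mevalXU mevalMn mulrDr; congr (_ + _).
  by rewrite mulrCA.
(* If [a_s = b_s] both sides vanish: the left one by its factor [g s], the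
   right one because [b + u_s] is not below [a]. *)
have [g0|gn0] := eqVneq (g s) 0%N.
  rewrite g0 mulr0n mulr0 (_ : lem _ a = false) ?mulr0 ?mul0rn //.
  apply/negP => /mnm_lepP/(_ s); rewrite mnmDE mnm1E eqxx addn1.
  by rewrite ltnNge -subn_eq0 gs g0 eqxx.
have bsa : lem (mnm_add b (mnm1 s)) a.
  apply/mnm_lepP => i; rewrite mnmDE mnm1E; have := mnm_lepP ba i.
  have [<-|_] := eqVneq s i; last by rewrite addn0.
  by move=> _; rewrite addn1 ltnNge -subn_eq0 gs.
rewrite bsa -submDA -/g; set g' := mnm_sub g (mnm1 s).
have -> : mdeg g = (mdeg g').+1.
  by rewrite -[g](@submK _ (mnm1 s)) ?lep1mP // mdegD mdeg1 addn1.
have := congr1 (fun k => k%:R : K) (mbin_shift a b s).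
rewrite gs !natrM => h.
rewrite exprS -[_ *+ g s]mulr_natr -[_ *+ (b s).+1]mulr_natr.
transitivity (e * e ^+ mdeg g' * ((mbin a b)%:R * (g s)%:R)
              * meval c (mderivm g' p)); first by ring.
by rewrite -h; ring.
Qed.

Definition shift_op s q : mpoly d K := c s *: q + e *: mderiv s q.

Lemma symbol_entry_sum (I : Type) (r : seq I) (F : I -> K)
    (G : I -> mpoly d K) a b :
  symbol_entry (\sum_(i <- r) F i *: G i) a b
  = \sum_(i <- r) F i * symbol_entry (G i) a b.
Proof.
rewrite /symbol_entry; case: ifP => _; last first.
  by rewrite big1 // => i _; rewrite mulr0.
rewrite !raddf_sum mulr_sumr; apply: eq_bigr => i _ /=.
by rewrite mderivmZ mevalZ mulrCA.
Qed.

(** The powers of the [T_s] are peeled off one factor at a time, in the order in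
    which they are composed; that the [T_s] commute is never needed. *)
Lemma mcoeff_foldr_shift_op (I : finType) (v : I -> K) (al : I -> multinom d)
    (m : multinom d) (t : seq 'I_d) b :
  mcoeff b (foldr (fun s => iter (m s) (shift_op s))
                  (\sum_i v i *: mpolyX K (al i)) t)
  = \sum_i v i
      * symbol_entry (\prod_(s <- t) mpolyX K (mnm1 s) ^+ m s) (al i) b.
Proof.
elim: t b => [|s t IH] b /=.
  rewrite raddf_sum; apply: eq_bigr => i _ /=.
  by rewrite big_nil symbol_entry1 mcoeffZ mcoeffX.
rewrite big_cons; elim: (m s) b => [|k IHk] b.
  by rewrite expr0 mul1r IH.
rewrite iterS {1}/shift_op mcoeffD !mcoeffZ mcoeff_mderiv !IHk.
rewrite !mulr_sumr -sumrMnl mulr_sumr -big_split; apply: eq_bigr => i _ /=.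
rewrite exprS -mulrA symbol_entry_mulX; ring.
Qed.

(** The case of a monomial of [p] is extended by linearity of [symbol_entry]
    in [p]. *)
Lemma mcoeff_sum_shift_op (I : finType) (v : I -> K) (al : I -> multinom d)
    p b :
  mcoeff b (\sum_(m <- msupp p) mcoeff m p *:
    foldr (fun s => iter (m s) (shift_op s))
          (\sum_i v i *: mpolyX K (al i)) (enum 'I_d))
  = \sum_i v i * symbol_entry p (al i) b.
Proof.
rewrite raddf_sum /=; under [RHS]eq_bigr => i _.
  rewrite [X in symbol_entry X]mpolyE symbol_entry_sum mulr_sumr.
  over.
rewrite exchange_big; apply: eq_bigr => m _.
rewrite mcoeffZ mcoeff_foldr_shift_op mulr_sumr; apply: eq_bigr => i _.
by rewrite big_enum -mpolyXE_id mulrCA.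
Qed.

End ConjugatedOperators.

(** * Differentials of complex-valued functions *)

Section ComplexDifferentials.
Variables (R : realType) (V : normedModType R).
Local Notation C := R[i].
Local Notation re := (@complex.Re R).
Local Notation im := (@complex.Im R).
Implicit Types (u w : V -> C) (x : V).

(** The differential is taken on real and imaginary parts, as in [pderiv]. *)
Definition has_cdiff u x (L : V -> C) : Prop :=
  is_diff x (re \o u) (re \o L) /\ is_diff x (im \o u) (im \o L).

Lemma has_cdiff_cst (c : C) x : has_cdiff (fun=> c) x (fun=> 0).
Proof. by split; exact: is_diff_cst. Qed.

Lemma has_cdiffD u w x L K : has_cdiff u x L -> has_cdiff w x K ->
  has_cdiff (fun y => u y + w y) x (fun h => L h + K h).
Proof.
move=> [u1 u2] [w1 w2]; split.
  have := is_diffD u1 w1; congr is_diff_def; apply/funext => y /=.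
    by rewrite !fctE /=; case: (u y); case: (w y).
  by rewrite !fctE /=; case: (L y); case: (K y).
have := is_diffD u2 w2; congr is_diff_def; apply/funext => y /=.
  by rewrite !fctE /=; case: (u y); case: (w y).
by rewrite !fctE /=; case: (L y); case: (K y).
Qed.

Lemma has_cdiffM u w x L K : has_cdiff u x L -> has_cdiff w x K ->
  has_cdiff (fun y => u y * w y) x (fun h => u x * K h + w x * L h).
Proof.
move=> [u1 u2] [w1 w2]; split.
  have := is_diffB (is_diffM u1 w1) (is_diffM u2 w2).
  congr is_diff_def; apply/funext => y /=.
    by rewrite !fctE /=; case: (u y); case: (w y).
  rewrite !fctE /= /GRing.scale /=.
  case: (u x) (w x) (K y) (L y) => [a b] [c e] [f g] [h k] /=; ring.
have := is_diffD (is_diffM u1 w2) (is_diffM u2 w1).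
congr is_diff_def; apply/funext => y /=.
  rewrite !fctE /=; case: (u y); case: (w y) => a b c e /=; ring.
rewrite !fctE /= /GRing.scale /=.
case: (u x) (w x) (K y) (L y) => [a b] [c e] [f g] [h k] /=; ring.
Qed.

Lemma is_diff_of_derive (f : R -> R) (a l : R) :
  is_derive a 1 f l -> is_diff a f (fun h => h * l).
Proof.
move=> fl; have df : differentiable f a by apply/derivable1_diffP; case: fl.
apply: DiffDef => //; rewrite diff1E // derive1E derive_val.
by apply/funext.
Qed.

Lemma has_cdiff_cexp u x L : has_cdiff u x L ->
  has_cdiff (fun y => cexp (u y)) x (fun h => cexp (u x) * L h).
Proof.
move=> [u1 u2].
have de := is_diff_comp u1 (is_diff_of_derive (is_derive_expR (re (u x)))).
have dc := is_diff_comp u2 (is_diff_of_derive (is_derive_cos (im (u x)))).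
have ds := is_diff_comp u2 (is_diff_of_derive (is_derive_sin (im (u x)))).
split.
  have := is_diffM de dc; congr is_diff_def; apply/funext => y /=.
    rewrite !fctE /cexp /=; ring.
  rewrite !fctE /cexp /= /GRing.scale /=.
  case: (L y) => a b /=; ring.
have := is_diffM de ds; congr is_diff_def; apply/funext => y /=.
  rewrite !fctE /cexp /=; ring.
rewrite !fctE /cexp /= /GRing.scale /=.
case: (L y) => a b /=; ring.
Qed.

End ComplexDifferentials.

(** * Exponential polynomials *)

Section PolynomialTimesExponential.
Variables (R : realType) (d : nat).
Local Notation C := R[i].
Local Notation re := (@complex.Re R).
Local Notation im := (@complex.Im R).
Implicit Types (x : 'rV[R]_d) (p q : mpoly d C) (s : 'I_d).

Definition rmeval q x : C := meval (fun s => (x 0 s)%:C) q.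

Lemma is_diff_coord (x : 'rV[R]_d) i k :
  is_diff x (fun y : 'rV[R]_d => y i k : R) (fun y => y i k).
Proof.
have @f : {linear 'rV[R]_d -> R}.
  by exists (fun N : 'rV[R]_d => N i k); do 2![eexists]; do ?[constructor];
     rewrite ?mxE// => ? *; rewrite ?mxE//; move=> ?; rewrite !mxE.
have fc : continuous f by exact: coord_continuous.
by apply: DiffDef; [exact: differentiable_coord|exact: (diff_lin x fc)].
Qed.

(** The polynomials whose formal derivatives compute the differential contain
    the constants and the variables, and are closed under sums and products. *)
Lemma has_cdiff_rmeval q x :
  has_cdiff (rmeval q) x
    (fun h => \sum_(s < d) rmeval (mderiv s q) x * (h 0 s)%:C).
Proof.
pose good q := has_cdiff (rmeval q) x
  (fun h => \sum_(s < d) rmeval (mderiv s q) x * (h 0 s)%:C).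
have goodC c : good (mpolyC d c).
  have := has_cdiff_cst c x; congr has_cdiff; apply/funext => h.
    by rewrite /rmeval mevalC.
  by rewrite big1 // => s _; rewrite mderivC /rmeval meval0 mul0r.
have goodX k : good (mpolyX C (mnm1 k)).
  rewrite /good; have -> : rmeval (mpolyX C (mnm1 k)) = (fun y => (y 0 k)%:C).
    by apply/funext => y; rewrite /rmeval mevalXU.
  have LE (h : 'rV[R]_d) :
      \sum_(s < d) rmeval (mderiv s (mpolyX C (mnm1 k))) x * (h 0 s)%:C
      = (h 0 k)%:C.
    rewrite (bigD1 k) //= big1 ?addr0 => [|s sk].
      by rewrite mderiv_mpolyXU eqxx /rmeval meval1 mul1r.
    by rewrite mderiv_mpolyXU eq_sym (negPf sk) /rmeval meval0 mul0r.
  split.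
    have := is_diff_coord x 0 k; congr is_diff_def; apply/funext => h //=.
    by rewrite LE.
  have := is_diff_cst (0 : R) x; congr is_diff_def; apply/funext => h //=.
  by rewrite LE.
have goodD p1 p2 : good p1 -> good p2 -> good (p1 + p2).
  move=> g1 g2; have := has_cdiffD g1 g2; congr has_cdiff; apply/funext => h.
    by rewrite /rmeval mevalD.
  rewrite -big_split; apply: eq_bigr => s _ /=.
  by rewrite /rmeval mderivD mevalD mulrDl.
have goodM p1 p2 : good p1 -> good p2 -> good (p1 * p2).
  move=> g1 g2; have := has_cdiffM g1 g2; congr has_cdiff; apply/funext => h.
    by rewrite /rmeval mevalM.
  rewrite !mulr_sumr -big_split; apply: eq_bigr => s _ /=.
  by rewrite /rmeval mderivM mevalD !mevalM; ring.
elim/mpolyind: q => [|c m q _ _ gq]; first by have := goodC 0; rewrite mpolyC0.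
apply: (goodD) => //; rewrite -mul_mpolyC; apply: (goodM) => //.
have good1 : good 1 by have := goodC 1; rewrite mpolyC1.
rewrite mpolyXE_id; apply: (big_ind good good1 goodM) => i _.
by elim: (m i) => [|k IH]; rewrite ?expr0 // exprS; apply: goodM.
Qed.

(** The phase [p] may be any polynomial: the derivatives of such products are
    again of this form, with the same phase. *)
Definition exp_mpoly p q x : C := cexp (rmeval p x) * rmeval q x.

Lemma has_cdiff_exp_mpoly p q x : has_cdiff (exp_mpoly p q) x
  (fun h => \sum_(s < d) exp_mpoly p (mderiv s p * q + mderiv s q) x
                           * (h 0 s)%:C).
Proof.
have := has_cdiffM (has_cdiff_cexp (has_cdiff_rmeval p x))
                   (has_cdiff_rmeval q x).
congr has_cdiff; apply/funext => h.
rewrite mulrCA !mulr_sumr -big_split; apply: eq_bigr => s _ /=.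
rewrite /exp_mpoly /rmeval mevalD mevalM; ring.
Qed.

Lemma pderiv_exp_mpoly s p q :
  pderiv s (exp_mpoly p q) = exp_mpoly p (mderiv s p * q + mderiv s q).
Proof.
apply/funext => x; have [r1 i1] := has_cdiff_exp_mpoly p q x.
have ev1 : \sum_(s0 < d) exp_mpoly p (mderiv s0 p * q + mderiv s0 q) x *
    ((delta_mx 0 s : 'rV[R]_d) 0 s0)%:C
    = exp_mpoly p (mderiv s p * q + mderiv s q) x.
  rewrite (bigD1 s) //= big1 ?addr0 => [|k ks]; last first.
    by rewrite mxE (negPf ks) andbF mulr0.
  by rewrite mxE !eqxx mulr1.
rewrite /pderiv !deriveE //; try exact: ex_diff.
by rewrite !diff_val /= ev1; case: (exp_mpoly _ _ _).
Qed.

Lemma smooth_exp_mpoly p q : smooth (exp_mpoly p q).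
Proof.
move=> t w; have [r ->] : exists r, w = exp_mpoly p r.
  rewrite /w; elim: t {w} => [|s t [r IH]] /=; first by exists q.
  by eexists; rewrite IH pderiv_exp_mpoly.
split=> [x|x|s x]; have [r1 i1] := has_cdiff_exp_mpoly p r x.
- exact/differentiable_continuous/(ex_diff (is_diff_def := r1)).
- exact/differentiable_continuous/(ex_diff (is_diff_def := i1)).
by split; apply: diff_derivable; apply: ex_diff.
Qed.

Lemma cexp_neq0 (z : C) : cexp z != 0.
Proof.
rewrite /cexp mulf_neq0 //.
  by rewrite eq_complex /= negb_and gt_eqF ?expR_gt0.
apply/eqP => /eqP; rewrite eq_complex /= => /andP[/eqP c0 /eqP s0].
have := cos2Dsin2 (im z); rewrite c0 s0 expr0n addr0 => /eqP.
by rewrite eq_sym oner_eq0.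
Qed.

(** The polynomials [r] such that [exp_mpoly p r] vanishes identically are stable
    under differentiation: where [r] and [(D_s p) r + D_s r] vanish, so does
    [D_s r].  Up to factorials, the coefficients of [q] are the values at the
    origin of its derivatives, and the exponential has no zero. *)
Lemma exp_mpoly_eq0 p q : exp_mpoly p q = (fun=> 0) -> q = 0.
Proof.
move=> q0; apply/mpolyP => m; rewrite mcoeff0.
have der r : exp_mpoly p r = (fun=> 0) ->
    forall s, exp_mpoly p (mderiv s r) = (fun=> 0).
  move=> r0 s; have := pderiv_exp_mpoly s p r.
  rewrite r0; set g := exp_mpoly p (_ + _) => gE.
  have gE0 : g = fun=> 0.
    rewrite -gE; apply/funext => x; rewrite /pderiv.
    by rewrite (_ : _ \o _ = cst 0) // (_ : _ \o _ = cst 0) // !derive_cst.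
  apply/funext => x; have := congr1 (fun f => f x) gE0.
  have := congr1 (fun f => f x) r0.
  rewrite /g /exp_mpoly /rmeval mevalD mevalM /= => h1 h2.
  by rewrite -[RHS]h2 mulrDr mulrCA h1 mulr0 add0r.
have dm : exp_mpoly p (mderivm m q) = (fun=> 0).
  rewrite mderivm_foldr; elim: (flatten _) => //= s t IH.
  exact: der.
have /eqP := congr1 (fun f => f 0) dm.
rewrite /= /exp_mpoly mulf_eq0 (negPf (cexp_neq0 _)) /= => /eqP.
have -> : rmeval (mderivm m q) 0 = mcoeff mnm0 (mderivm m q).
  rewrite /rmeval; elim/mpolyind: (mderivm m q) => [|c a r _ _ IH].
    by rewrite meval0 mcoeff0.
  rewrite mevalD mevalZ mevalX mcoeffD mcoeffZ mcoeffX IH; congr (_ * _ + _).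
  have [->|a0] := eqVneq a mnm0.
    by rewrite big1 // => i _; rewrite mnm0E expr0.
  have [i ai] := mnm_neq0_exists a0.
  by rewrite (bigD1 i) //= mxE expr0n (negPf ai) mul0r.
rewrite mcoeff_mderivm addm0 => /eqP; rewrite mulrn_eq0 => /orP[|/eqP //].
rewrite -leqn0 leqNgt prodn_gt0 // => i.
by rewrite ffact_gt0.
Qed.

End PolynomialTimesExponential.

(** * The system of differential equations *)

Section ExpPolySystem.
Variables (R : realType) (d : nat) (x0 : 'rV[R[i]]_d).
Local Notation C := R[i].
Implicit Types (p q : mpoly d C) (s : 'I_d).

Definition phase : mpoly d C :=
  \sum_(s < d) ('i%C * x0 0 s) *: mpolyX C (mnm1 s).

Lemma rmeval_phase (x : 'rV[R]_d) :
  rmeval phase x = 'i%C * \sum_(s < d) x0 0 s * (x 0 s)%:C.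
Proof.
rewrite /rmeval raddf_sum mulr_sumr; apply: eq_bigr => s _ /=.
by rewrite mevalZ mevalXU mulrA.
Qed.

Lemma mderiv_phase s : mderiv s phase = mpolyC d ('i%C * x0 0 s).
Proof.
rewrite raddf_sum (bigD1 s) //= big1 ?addr0 => [|k ks].
  by rewrite mderivZ mderiv_mpolyXU eqxx alg_mpolyC.
by rewrite mderivZ mderiv_mpolyXU (negPf ks) scaler0.
Qed.

(** The factor [- 'i] cancels the ['i] of the phase, whence [x0_s + e D_s] with
    [e = - 'i]. *)
Lemma miD_exp_mpoly s q :
  miD s (exp_mpoly phase q)
  = exp_mpoly phase (shift_op (- 'i%C) (x0 0) s q).
Proof.
apply/funext => x.
rewrite /miD pderiv_exp_mpoly mderiv_phase /exp_mpoly /rmeval /shift_op.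
rewrite !mevalD mevalM mevalC !mevalZ.
have i2 : - 'i%C * 'i%C = 1 :> C by rewrite mulNr -expr2 sqr_i opprK.
by rewrite mulrCA mulrDr !mulrA i2 mul1r.
Qed.

Lemma diff_op_exp_mpoly P q :
  diff_op P (exp_mpoly phase q)
  = exp_mpoly phase (\sum_(m <- msupp P) mcoeff m P *:
      foldr (fun s => iter (m s) (shift_op (- 'i%C) (x0 0) s)) q (enum 'I_d)).
Proof.
have miD_powE m : miD_pow m (exp_mpoly phase q) = exp_mpoly phase
    (foldr (fun s => iter (m s) (shift_op (- 'i%C) (x0 0) s)) q (enum 'I_d)).
  rewrite /miD_pow; elim: (enum _) => //= s t ->.
  by elim: (m s) => //= k ->; rewrite miD_exp_mpoly.
apply/funext => x; rewrite /diff_op [RHS]/exp_mpoly.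
rewrite /rmeval [X in _ * X]raddf_sum mulr_sumr.
by apply: eq_bigr => m _ /=; rewrite miD_powE mevalZ mulrCA.
Qed.

Variables (l : nat) (v : 'cV[C]_(dtilde d l)).

Lemma exp_polyE :
  exp_poly x0 v
  = exp_mpoly phase (\sum_j v j 0 *: mpolyX C (multi_index j)).
Proof.
apply/funext => x; rewrite /exp_poly /exp_mpoly rmeval_phase; congr (_ * _).
rewrite mxE /rmeval raddf_sum; apply: eq_bigr => j _ /=.
by rewrite mevalZ mevalX mxE mulrC.
Qed.

Lemma Dtilde_mulE P i :
  (Dtilde l P x0 *m v) i 0
  = \sum_j v j 0
      * symbol_entry (- 'i%C) (x0 0) P (multi_index j) (multi_index i).
Proof. by rewrite mxE; apply: eq_bigr => j _; rewrite mxE mulrC. Qed.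

(** An entry of [Dtilde P x0 *m v] is a coefficient of the polynomial factor of
    the image of [exp_poly x0 v].  The coefficients of degree larger than [l],
    which the matrix does not record, vanish: [X^b] occurs in the image of [X^a]
    only for [b <= a]. *)
Lemma diff_op_exp_poly_eq0 P :
  diff_op P (exp_poly x0 v) = (fun=> 0) <-> Dtilde l P x0 *m v = 0.
Proof.
rewrite exp_polyE diff_op_exp_mpoly; split=> [/exp_mpoly_eq0 r0|Dv0].
  apply/colP => i; rewrite Dtilde_mulE -mcoeff_sum_shift_op r0.
  by rewrite mcoeff0 mxE.
set r := (X in exp_mpoly _ X); suff -> : r = 0.
  by apply/funext => x; rewrite /exp_mpoly /rmeval meval0 mulr0.
apply/mpolyP => b; rewrite mcoeff_sum_shift_op mcoeff0.
have [bl|bl] := leqP (mdeg b) l.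
  have [i ->] : exists i : 'I_(dtilde d l), b = multi_index i.
    have bin : b \in indices_le d l by rewrite mem_indices_le.
    have lt : (index b (indices_le d l) < dtilde d l)%N.
      by rewrite -size_indices_le index_mem.
    by exists (Ordinal lt); rewrite /multi_index nth_index.
  by rewrite -Dtilde_mulE Dv0 mxE.
rewrite big1 // => j _; rewrite /symbol_entry; case: ifP; rewrite ?mulr0 //.
move=> /lem_mdeg bj; have := leq_ltn_trans (mdeg_multi_index j) bl.
by rewrite ltnNge bj.
Qed.

(** In the row of a multi-index [a] of maximal length with [v_a <> 0], an entry
    off the diagonal is zero unless its column is strictly longer than [a], where
    [v] vanishes.  What remains is [P(x0) v_a]. *)
Lemma Dtilde_mul_eq0_root P :
  v != 0 -> Dtilde l P x0 *m v = 0 -> meval (x0 0) P = 0.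
Proof.
move=> v0 Dv0; have [i0 vi0] : exists i, v i 0 != 0.
  apply/existsP; apply: contraNT v0 => /existsPn v0; apply/eqP/colP => i.
  by apply/eqP; rewrite mxE -[_ == _]negbK v0.
pose deg (i : 'I_(dtilde d l)) := mdeg (multi_index i).
case: (@arg_maxnP _ i0 (fun i => v i 0 != 0) deg vi0) => i vi imax.
have := Dtilde_mulE P i; rewrite Dv0 mxE (bigD1 i) //= big1 ?addr0 => [|j ji].
  by rewrite symbol_entry_diag => /esym/eqP; rewrite mulf_eq0 (negPf vi) => /eqP.
have [->|vj] := eqVneq (v j 0) 0; first by rewrite mul0r.
rewrite /symbol_entry; case: ifP => [ij|]; last by rewrite mulr0.
case/eqP: ji; apply: multi_index_inj; apply/esym.
by apply: lem_mdeg_eq => //; apply: imax.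
Qed.

End ExpPolySystem.

Lemma null_space_mxcol (K : pzRingType) (m n p : nat) (A : 'I_n -> 'M[K]_(m, p))
    (v : 'cV[K]_p) :
  null_space (\mxcol_(j < n) A j) v <-> forall j, A j *m v = 0.
Proof.
rewrite /null_space /= mxcol_mul -mxcol0; split=> [/eq_mxcolP|] Av0.
  exact: Av0.
exact/eq_mxcolP.
Qed.

Theorem proposition4p5 (R : realType) (d n l : nat)
  (hd : (0 < d)%N) (hn : (0 < n)%N)
  (P : 'I_n -> mpoly d R[i]) (x0 : 'rV[R[i]]_d) (v : 'cV[R[i]]_(dtilde d l))
  (hv : exists x : 'rV[R]_d, exp_poly x0 v x <> 0) :
  (\bigcap_(j in [set: 'I_n]) ker_op (P j)) (exp_poly x0 v)
  <->
  (null_space (\mxcol_(j < n) Dtilde l (P j) x0) v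
   /\ forall j : 'I_n, meval (x0 0) (P j) = 0).
Proof.
have v0 : v != 0.
  by apply/eqP => v0; case: hv => x; apply; rewrite /exp_poly v0 mulmx0 mxE mulr0.
rewrite null_space_mxcol; split=> [keru|[Dv0 _] j _].
  have Dv0 j : Dtilde l (P j) x0 *m v = 0.
    by apply/diff_op_exp_poly_eq0/funext => x; have [_ ->] := keru j I.
  by split=> // j; apply: Dtilde_mul_eq0_root (Dv0 j).
split; first by rewrite exp_polyE; apply: smooth_exp_mpoly.
by move=> x; move/diff_op_exp_poly_eq0: (Dv0 j) => ->.
Qed.
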